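(* Let $b>1$ be real. Then $$\pi=\frac{2b^2(b^2-1)\,K\!\left(\dfrac{2b}{1+b^2}\right)}{(1+b^2)\left(2(b^2-1)\,F_1\!\left(\tfrac12;1,\tfrac12;1\,\Big|\,\dfrac1{b^2},\dfrac1{b^4}\right)-b^2\right)}.$$
   Context: $K(k)=\int_0^1\frac{dx}{\sqrt{(1-x^2)(1-k^2x^2)}}$ is the complete elliptic integral of the first kind, as a function of the modulus $k$. The two-variable Appell function is $F_1(\alpha;\beta_1,\beta_2;\gamma\,|\,x,y)=\sum_{m,n\ge0}\frac{(\alpha)_{m+n}(\beta_1)_m(\beta_2)_n}{(\gamma)_{m+n}\,m!\,n!}x^my^n$ for $|x|,|y|<1$, with $(x)_k$ the Pochhammer symbol. For $\operatorname{Re}\gamma>\operatorname{Re}\alpha>0$ it equals, and outside the region of convergence is defined by analytic continuation through, $\frac{\Gamma(\gamma)}{\Gamma(\alpha)\Gamma(\gamma-\alpha)}\int_0^1\frac{u^{\alpha-1}(1-u)^{\gamma-\alpha-1}}{(1-xu)^{\beta_1}(1-yu)^{\beta_2}}\,du$ (principal branches, $x,y\notin[1,\infty)$). *)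

(* Defs.v *)
From mathcomp Require Import all_boot all_order all_algebra.
From mathcomp Require Import all_classical all_reals all_analysis.

Set Implicit Arguments.
Unset Strict Implicit.
Unset Printing Implicit Defensive.

Import Order.TTheory GRing.Theory Num.Theory.
Import numFieldNormedType.Exports.

Local Open Scope classical_set_scope.
Local Open Scope ring_scope.

(* The argument [k] is the elliptic modulus, not the parameter [m = k ^+ 2]. *)
Definition ellipticK (R : realType) (k : R) : R :=
  \int[@lebesgue_measure R]_(x in `[0, 1[)
    (1 / Num.sqrt ((1 - x ^+ 2) * (1 - k ^+ 2 * x ^+ 2))).

Definition pochhammer (R : realType) (x : R) (k : nat) : R :=
  \prod_(0 <= i < k) (x + i%:R).

Definition appellF1_term (R : realType) (alpha beta1 beta2 gamma x y : R)
    (m n : nat) : R :=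
  pochhammer alpha (m + n) * pochhammer beta1 m * pochhammer beta2 n
    / (pochhammer gamma (m + n) * m`!%:R * n`!%:R) * x ^+ m * y ^+ n.

(* Meaningful only for [`|x| < 1], [`|y| < 1] and [gamma] not a nonpositive
   integer: the double series then converges absolutely, so that it may be
   summed iteratively. The analytic continuation is not covered. *)
Definition appellF1 (R : realType) (alpha beta1 beta2 gamma x y : R) : R :=
  limn (series (fun m : nat =>
    limn (series (fun n : nat =>
      appellF1_term alpha beta1 beta2 gamma x y m n)))).

(* Main.v *)
Require Import Defs.
From mathcomp Require Import all_boot all_order all_algebra.
From mathcomp Require Import all_classical all_reals all_analysis.
From mathcomp Require Import measurable_realfun.
From mathcomp.real_closed Require Import complex.
From mathcomp Require Import ring lra zify.

Set Implicit Arguments.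
Unset Strict Implicit.
Unset Printing Implicit Defensive.

Import Order.TTheory GRing.Theory Num.Theory.
Import numFieldNormedType.Exports.

Local Open Scope classical_set_scope.
Local Open Scope ring_scope.

(** Put [q = 1 / b ^+ 2], let [c n] be the Taylor coefficients of
    [(1 - z) ^ (-1/2)], and let [S] be the sum of the [(c n * q ^+ n) ^+ 2].
    Both transcendental quantities of the theorem are affine in [S].

    The Appell series.  Since [c n = (1/2)_n / n!], the general term of
    [F_1(1/2; 1, 1/2; 1 | q, q^2)] is [(c (m + n) * q ^+ (m + n)) *
    (c n * q ^+ n)], so the double series runs over the pairs [n <= m + n] of
    indices of the symmetric double series with general term
    [(c i * q ^+ i) * (c j * q ^+ j)].  Twice the sum over this half is the
    whole square plus the diagonal, and the whole square is the square of
    [(1 - q) ^ (-1/2)]; hence [2 F_1 = 1 / (1 - q) + S] ([appellF1_half]).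

    The elliptic integral.  With [x = sin t] and [k = 2b / (1 + b^2)], that is
    [k^2 = 4q / (1 + q)^2], the quantity [1 - k^2 (sin t)^2] is
    [|1 - z|^2 / (1 + q)^2] for [z = - q e^(2it)].  So [K(k)] is [1 + q] times
    the integral over a quarter turn of [|1 - z|^-1], which is the squared
    modulus of the sum of the [c n * z ^+ n]; by orthogonality of the
    characters this integral is [pi / 2 * S] ([ellipticK_series]).

    Eliminating [S] gives the formula.

    Analysis is kept to a minimum by working with the partial sums [P] of the
    series of [(1 - z) ^ (-1/2)]: the polynomial [(1 - z) * P ^+ 2 - 1] has
    bounded coefficients and starts in high degree, which yields an explicit
    geometric bound, uniform on the circle ([isqrt_trunc_bound]).  That one
    estimate, used at the real point [q] and at the complex points [z], gives
    both limits. *)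

(** * Partial sums of the series of the inverse square root *)

Section InverseSqrtSeries.
Context {F : numFieldType}.
Implicit Types (z : F) (n N : nat).

(** The Taylor coefficients of [(1 - z) ^ (-1/2)], as a product of ratios so
    that they make sense both in the reals and in the complex numbers. *)
Definition isqrt_coef n : F := \prod_(i < n) ((2 * i + 1)%:R / (2 * i + 2)%:R).

Local Notation c := isqrt_coef.

Lemma isqrt_coef0 : c 0 = 1. Proof. by rewrite /c big_ord0. Qed.

Lemma isqrt_coef_rec n : 2 * (n.+1%:R * c n.+1) = (2 * n%:R + 1) * c n.
Proof.
rewrite /c big_ord_recr /=.
have h : (2 * n + 2)%:R != 0 :> F by rewrite pnatr_eq0; lia.
have -> : (2 * n + 1)%:R = 2 * n%:R + 1 :> F by rewrite natrD natrM.
have e : (2 * n + 2)%:R = 2 * n.+1%:R :> F.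
  by rewrite -natrM; congr (_%:R); lia.
by rewrite mulrA -e mulrCA mulrC [_ * (_ / _)]mulrC divfK// mulrC.
Qed.

Lemma isqrt_coef_ge0 n : 0 <= c n.
Proof. by apply: prodr_ge0 => i _; rewrite divr_ge0. Qed.

(** This is the identity [((1 - z) ^ (-1/2)) ^+ 2 = 1 / (1 - z)] on
    coefficients.  The sum weighted by the first index, [w], equals half of
    [n] times the plain sum by symmetry, while the recurrence of the
    coefficients computes [w n.+1] from [w n]; comparing the two shows that the
    plain sum does not depend on [n]. *)
Lemma isqrt_coef_conv n : \sum_(i < n.+1) c i * c (n - i) = 1.
Proof.
pose w m := \sum_(i < m.+1) i%:R * (c i * c (m - i)).
have w2 m : 2 * w m = m%:R * \sum_(i < m.+1) c i * c (m - i).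
  rewrite mulr_natl mulr2n {2}/w (reindex_inj rev_ord_inj)/= /w -big_split/=.
  rewrite mulr_sumr; apply: eq_bigr => i _.
  rewrite subSS subKn -1?ltnS// [c (m - i) * _]mulrC -mulrDl.
  by rewrite -natrD subnKC// -ltnS.
elim: n => [|n IH]; first by rewrite big_ord_recr big_ord0/= isqrt_coef0; ring.
apply: (@mulfI _ n.+1%:R); first by rewrite pnatr_eq0.
rewrite -w2 /w big_ord_recl/= mul0r add0r mulr_sumr.
have -> : \sum_(i < n.+1)
    2 * ((bump 0 i)%:R * (c (bump 0 i) * c (n.+1 - bump 0 i)))
  = 2 * w n + \sum_(i < n.+1) c i * c (n - i).
  rewrite /w mulr_sumr -big_split/=; apply: eq_bigr => i _.
  rewrite /bump/= add1n subSS.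
  rewrite [X in 2 * X]mulrA [2 * _]mulrA isqrt_coef_rec; ring.
by rewrite w2 IH !mulr1 natr1.
Qed.

Definition isqrt_trunc N : {poly F} := \poly_(i < N) c i.

(** A coefficient of the square of the truncation is a subsum of the
    convolution sum, and the whole of it below the truncation degree. *)
Lemma isqrt_trunc_sqr_coef N n :
  0 <= ((isqrt_trunc N) ^+ 2)`_n <= 1
  /\ ((n < N)%N -> ((isqrt_trunc N) ^+ 2)`_n = 1).
Proof.
rewrite expr2 coefM; split; last first.
  move=> nN; rewrite -[RHS](isqrt_coef_conv n); apply: eq_bigr => i _.
  by rewrite !coef_poly !ifT//; have := ltn_ord i; lia.
apply/andP; split.
  by apply: sumr_ge0 => i _; rewrite !coef_poly; do 2 case: ifP => _;
    rewrite ?mulr_ge0 ?isqrt_coef_ge0.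
rewrite -[leRHS](isqrt_coef_conv n); apply: ler_sum => i _.
by rewrite !coef_poly; do 2 case: ifP => _;
  rewrite ?mul0r ?mulr0 ?mulr_ge0 ?isqrt_coef_ge0.
Qed.

Lemma horner_tail_bound (p : {poly F}) N z : `|z| < 1 ->
  (forall i, `|p`_i| <= 1) -> (forall i, (i < N)%N -> p`_i = 0) ->
  `|p.[z]| <= `|z| ^+ N / (1 - `|z|).
Proof.
move=> z1 p1 p0; have z1' : 0 < 1 - `|z| by rewrite subr_gt0.
rewrite ler_pdivlMr// horner_coef.
have geo M :
  (\sum_(i < M) if (i < N)%N then 0 else `|z| ^+ i) * (1 - `|z|) <= `|z| ^+ N.
  suff : (\sum_(i < M) if (i < N)%N then 0 else `|z| ^+ i) * (1 - `|z|)
     <= `|z| ^+ N - `|z| ^+ (maxn M N).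
    by move=> /le_trans; apply; rewrite gerBl exprn_ge0.
  elim: M => [|M IH]; first by rewrite big_ord0 mul0r max0n subrr.
  rewrite big_ord_recr/=; case: ltnP => MN.
    by rewrite addr0 (_ : maxn M.+1 N = maxn M N)//; lia.
  rewrite mulrDl (le_trans (lerD IH (lexx _)))//.
  have -> : maxn M N = M by lia.
  have -> : maxn M.+1 N = M.+1 by lia.
  by rewrite exprS le_eqVlt; apply/orP; left; apply/eqP; ring.
apply: le_trans (geo (size p)); rewrite ler_pM2r//.
apply: le_trans (ler_norm_sum _ _ _) _; apply: ler_sum => i _.
case: ltnP => iN; first by rewrite p0// mul0r normr0.
by rewrite normrM normrX ler_piMl ?exprn_ge0.
Qed.

(** Multiplying by [1 - z] takes differences of consecutive coefficients of the
    squared truncation: these vanish as long as the coefficients are [1], and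
    are differences of two numbers of [[0, 1]] afterwards. *)
Lemma isqrt_trunc_bound N z : `|z| < 1 ->
  `|(1 - z) * (\sum_(i < N) c i * z ^+ i) ^+ 2 - 1| <= `|z| ^+ N / (1 - `|z|).
Proof.
move=> z1; rewrite -horner_poly -/(isqrt_trunc N).
pose q := (1 - 'X) * isqrt_trunc N ^+ 2 - 1.
have -> : (1 - z) * (isqrt_trunc N).[z] ^+ 2 - 1 = q.[z] by rewrite /q !hornerE.
have qE i : q`_i = (isqrt_trunc N ^+ 2)`_i
   - (if i is i'.+1 then (isqrt_trunc N ^+ 2)`_i' else 0) - (i == 0)%:R.
  by rewrite /q mulrBl mul1r !coefB coefXM coef1; case: i.
apply: horner_tail_bound => // i; rewrite qE.
  have [/andP[a0 a1] _] := isqrt_trunc_sqr_coef N i.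
  case: i a0 a1 => [|i] a0 a1.
    by rewrite subr0 distrC ger0_norm ?subr_ge0// lerBlDr lerDl.
  have [/andP[b0 b1] _] := isqrt_trunc_sqr_coef N i.
  rewrite subr0 real_ler_norml ?realB ?ger0_real//.
  rewrite lerBrDr addrC (le_trans _ a0) ?subr_le0//=.
  by rewrite lerBlDr (le_trans a1)// lerDl.
move=> iN; have [_ ->//] := isqrt_trunc_sqr_coef N i.
case: i iN => [|i] iN; first by rewrite subr0 subrr.
by have [_ ->] := isqrt_trunc_sqr_coef N i; rewrite ?subrr ?subr0//; lia.
Qed.

End InverseSqrtSeries.

Lemma cvg_geometric_dist (R : realType) (u : nat -> R) (l r C : R) : `|r| < 1 ->
  (forall N, `|l - u N| <= `|r| ^+ N * C) -> u @ \oo --> l.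
Proof.
move=> r1 bound; apply/cvgrPdist_le => e e0.
have geo : (fun N => `|r| ^+ N * C) @ \oo --> 0.
  rewrite -[X in _ --> X](mul0r C); apply: cvgMr_tmp.
  have := @cvg_geometric R 1 `|r|; rewrite normr_id => /(_ r1).
  by under eq_cvg do rewrite /= mul1r.
have geo_e := cvgr_le _ geo _ e0.
by near=> N; apply: le_trans (bound N) _; near: N; exact: geo_e.
Unshelve. all: by end_near. Qed.

(** * The Appell series *)

Section Appell.
Context {R : realType}.
Local Notation c := (@isqrt_coef R).

Lemma ler_sum_widen (f : nat -> R) (m n : nat) : (m <= n)%N ->
  (forall i, 0 <= f i) -> \sum_(i < m) f i <= \sum_(i < n) f i.
Proof.
move=> mn f0; rewrite -!(big_mkord xpredT) (@big_cat_nat _ _ _ m 0 n)//= lerDl.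
by apply: sumr_ge0.
Qed.

(** Triangular and rectangular partial sums are cofinal in one another when the
    terms are nonnegative: a rectangle is contained in a large triangle, and a
    triangle in the strip of the same height. *)
Lemma triangular_iterated_series (a : nat -> nat -> R) (l : R) :
  (forall m n, 0 <= a m n) ->
  (fun L => \sum_(m < L) \sum_(n < L - m) a m n) @ \oo --> l ->
  limn (series (fun m => limn (series (a m)))) = l.
Proof.
move=> a0; set U := fun L => _ => Ul.
have Und : nondecreasing_seq U.
  move=> L L' LL'; rewrite /U.
  apply: (le_trans (y := \sum_(m < L) \sum_(n < L' - m) a m n)).
    by apply: ler_sum => m _; apply: ler_sum_widen => //; exact: leq_sub2r.
  apply: (@ler_sum_widen (fun m => \sum_(n < L' - m) a m n)) => // m.
  exact: sumr_ge0.
have Ule L : U L <= l.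
  rewrite -(cvg_lim _ Ul)//; apply: nondecreasing_cvgn_le => //.
  exact: cvgP Ul.
have rect M N : \sum_(m < M) \sum_(n < N) a m n <= l.
  apply: le_trans (Ule (M + N)%N); rewrite /U.
  apply: (le_trans (y := \sum_(m < M) \sum_(n < M + N - m) a m n)).
    by apply: ler_sum => m _; apply: ler_sum_widen => //; have := ltn_ord m; lia.
  apply: (@ler_sum_widen (fun m => \sum_(n < M + N - m) a m n)) => [|m].
    exact: leq_addr.
  exact: sumr_ge0.
have nda m : nondecreasing_seq (series (a m)).
  by apply: nondecreasing_series.
have cva m : cvgn (series (a m)).
  apply: nondecreasing_is_cvgn => //; exists l => _ [N _ <-].
  rewrite /series/= big_mkord; apply: le_trans (rect m.+1 N).
  by rewrite big_ord_recr/= lerDr; apply: sumr_ge0 => *; exact: sumr_ge0.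
apply/cvg_lim => //.
apply: (squeeze_cvgr _ Ul (cvg_cst l)); near=> L; apply/andP; split.
  rewrite /U /series/= big_mkord; apply: ler_sum => m _.
  have := nondecreasing_cvgn_le (nda m) (cva m) (L - m)%N.
  by rewrite {1}/series/= big_mkord.
rewrite /series/=.
have cs : \sum_(0 <= m < L) (series (a m) N) @[N --> \oo] -->
    \sum_(0 <= m < L) limn (series (a m)).
  apply: cvg_big; first exact: add_continuous.
  by move=> m _; exact: cva.
rewrite -(cvg_lim _ cs)//; apply: limr_le; first exact: cvgP cs.
near=> N; rewrite big_mkord; apply: le_trans (rect L N).
by apply: ler_sum => m _; rewrite /series/= big_mkord.
Unshelve. all: by end_near. Qed.

Lemma pochhammerS (x : R) n : pochhammer x n.+1 = pochhammer x n * (x + n%:R).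
Proof. by rewrite /pochhammer big_nat_recr. Qed.

Lemma pochhammer1 n : pochhammer 1 n = n`!%:R :> R.
Proof.
elim: n => [|n IH]; first by rewrite /pochhammer big_geq.
by rewrite pochhammerS IH factS natrM -nat1r mulrC.
Qed.

Lemma pochhammer_half n : pochhammer (1 / 2) n = c n * n`!%:R :> R.
Proof.
elim: n => [|n IH]; first by rewrite /pochhammer big_geq// isqrt_coef0 mulr1.
have h := @isqrt_coef_rec R n.
apply: (@mulfI _ 2) => //; rewrite pochhammerS IH factS natrM.
transitivity (2 * (n.+1%:R * c n.+1) * n`!%:R); last by ring.
by rewrite h; field.
Qed.

Lemma appellF1_term_half (x y : R) m n :
  appellF1_term (1 / 2) 1 (1 / 2) 1 x y m n
  = c (m + n) * c n * x ^+ m * y ^+ n.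
Proof.
have f0 k : k`!%:R != 0 :> R by rewrite pnatr_eq0 -lt0n fact_gt0.
rewrite /appellF1_term !pochhammer1 !pochhammer_half; field.
by rewrite !f0.
Qed.

(** The triangle [m + n < L] parametrizes the index pairs [(m + n, n)] on or
    below the diagonal of the square of side [L]. *)
Lemma sqr_sum_triangular (u : nat -> R) L :
  (\sum_(i < L) u i) ^+ 2 =
  2 * (\sum_(m < L) \sum_(n < L - m) u (m + n)%N * u n) - \sum_(i < L) u i ^+ 2.
Proof.
elim: L => [|L IH]; first by rewrite !big_ord0 expr2 !mulr0 subrr.
have step : \sum_(m < L.+1) \sum_(n < L.+1 - m) u (m + n)%N * u n =
  \sum_(m < L) \sum_(n < L - m) u (m + n)%N * u n + u L * \sum_(m < L.+1) u m.
  transitivity (\sum_(m < L.+1)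
    (\sum_(n < L - m) u (m + n)%N * u n + u L * u (L - m)%N)).
    apply: eq_bigr => m _; have mL : (m <= L)%N by rewrite -ltnS.
    by rewrite subSn// big_ord_recr/= subnKC.
  rewrite big_split/= big_ord_recr/= subnn big_ord0 addr0 -mulr_sumr.
  congr (_ + _ * _); rewrite (reindex_inj rev_ord_inj)/=.
  by apply: eq_bigr => m _; rewrite subSS subKn// -ltnS.
by rewrite step !big_ord_recr/= sqrrD IH; ring.
Qed.

Lemma isqrt_series_sqr_cvg (q : R) : `|q| < 1 ->
  (fun L => (\sum_(i < L) c i * q ^+ i) ^+ 2) @ \oo --> 1 / (1 - q).
Proof.
move=> q1; have q10 : 0 < 1 - q by rewrite subr_gt0 (le_lt_trans (ler_norm q)).
apply: (cvg_geometric_dist (C := (1 - `|q|)^-1 / (1 - q)) q1) => L.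
have -> : 1 / (1 - q) - (\sum_(i < L) c i * q ^+ i) ^+ 2
  = - ((1 - q) * (\sum_(i < L) c i * q ^+ i) ^+ 2 - 1) / (1 - q).
  by field; rewrite gt_eqF.
rewrite normrM normrN normfV (gtr0_norm q10) [leRHS]mulrA ler_pM2r ?invr_gt0//.
exact: isqrt_trunc_bound.
Qed.

(** At arguments [q] and [q ^+ 2] the general term splits as [u (m + n) * u n] for
    [u i = c i * q ^+ i], so that the triangular partial sums are half of the
    sum of a square and of its diagonal. *)
Lemma appellF1_half (q s : R) : 0 <= q < 1 ->
  series (fun i => (c i * q ^+ i) ^+ 2) @ \oo --> s ->
  appellF1 (1 / 2) 1 (1 / 2) 1 q (q ^+ 2) = (1 / (1 - q) + s) / 2.
Proof.
move=> /andP[q0 q1] Ss; pose u i := c i * q ^+ i.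
have termE m n :
    appellF1_term (1 / 2) 1 (1 / 2) 1 q (q ^+ 2) m n = u (m + n)%N * u n.
  by rewrite appellF1_term_half /u exprD -exprM mulnC exprM expr2; ring.
apply: triangular_iterated_series => [m n|].
  by rewrite termE !mulr_ge0 ?exprn_ge0 ?isqrt_coef_ge0.
have -> : (fun L => \sum_(m < L) \sum_(n < L - m)
      appellF1_term (1 / 2) 1 (1 / 2) 1 q (q ^+ 2) m n)
  = (fun L => ((\sum_(i < L) u i) ^+ 2 + series (fun i => u i ^+ 2) L) / 2).
  apply/funext => L; rewrite sqr_sum_triangular /series/= big_mkord subrK.
  rewrite [RHS]mulrC mulKf//; apply: eq_bigr => m _.
  by apply: eq_bigr => n _; rewrite termE.
apply: cvgMr_tmp; apply: cvgD => //.
by apply: isqrt_series_sqr_cvg; rewrite ger0_norm.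
Qed.

End Appell.

(** * Fourier expansion of the inverse distance to the unit *)

Section Fourier.
Context {R : realType}.
Implicit Types (r t : R) (n N : nat).
Notation mu := (@lebesgue_measure R).
Local Notation c := (@isqrt_coef R).

(** The squared modulus of the truncated series of [(1 - z) ^ (-1/2)] at
    [z = r e^(it)], expanded into cosines. *)
Definition isqrt_fourier r N t : R :=
  \sum_(i < N) \sum_(j < N) c i * c j * r ^+ (i + j) * cos ((i%:R - j%:R) * t).

Lemma isqrt_fourier_sqr r N t :
  isqrt_fourier r N t = (\sum_(i < N) c i * (r ^+ i * cos (i%:R * t))) ^+ 2
    + (\sum_(i < N) c i * (r ^+ i * sin (i%:R * t))) ^+ 2.
Proof.
rewrite !expr2 !mulr_suml -big_split; apply: eq_bigr => i _ /=.
rewrite !mulr_sumr -big_split; apply: eq_bigr => j _ /=.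
by rewrite mulrBl cosB exprD; ring.
Qed.

Local Open Scope complex_scope.

Lemma exp_polar r t n :
  (Complex (r * cos t) (r * sin t)) ^+ n
  = Complex (r ^+ n * cos (n%:R * t)) (r ^+ n * sin (n%:R * t)).
Proof.
elim: n => [|n IH]; first by rewrite !expr0 mul0r cos0 sin0 mul1r mulr0.
rewrite exprS IH -natr1 mulrDl mul1r addrC cosD sinD exprS.
by congr Complex; ring.
Qed.

Lemma real_complex_isqrt_coef n : (c n)%:C = isqrt_coef n :> R[i].
Proof.
rewrite /isqrt_coef rmorph_prod; apply: eq_bigr => i _.
by rewrite rmorphM fmorphV !rmorph_nat.
Qed.

(** The estimate on the truncated series at [z = r e^(it)], after the reverse
    triangle inequality: the square root is [|1 - z|]. *)
Lemma isqrt_fourier_bound r N t : `|r| < 1 ->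
  `|Num.sqrt (1 - 2 * r * cos t + r ^+ 2) * isqrt_fourier r N t - 1|
    <= `|r| ^+ N / (1 - `|r|).
Proof.
move=> r1; set z := Complex (r * cos t) (r * sin t).
have zr : `|z| = `|r|%:C.
  rewrite normc_def /=; congr (_%:C); rewrite -sqrtr_sqr; congr Num.sqrt.
  by rewrite !exprMn -mulrDr cos2Dsin2 mulr1.
have z1 : `|z| < 1 by rewrite zr -[1]/(1%:C) ltcR.
have := isqrt_trunc_bound N z1.
have -> : \sum_(i < N) isqrt_coef i * z ^+ i =
  Complex (\sum_(i < N) c i * (r ^+ i * cos (i%:R * t)))
          (\sum_(i < N) c i * (r ^+ i * sin (i%:R * t))).
  elim: N => [|N IH]; first by rewrite !big_ord0.
  rewrite !big_ord_recr/= IH -real_complex_isqrt_coef exp_polar.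
  by apply/eqP; rewrite eq_complex/= !mul0r subr0 addr0 !eqxx.
set P := Complex _ _ => h.
have : `|(`|1 - z| * `|P| ^+ 2) - 1| <= `|z| ^+ N / (1 - `|z|).
  apply: le_trans h; have := ler_dist_dist ((1 - z) * P ^+ 2) 1.
  by rewrite normr1 normrM normrX.
rewrite zr -add_Re2_Im2 -isqrt_fourier_sqr.
have -> : `|1 - z| = (Num.sqrt (1 - 2 * r * cos t + r ^+ 2))%:C.
  rewrite normc_def; congr (Num.sqrt _)%:C => /=.
  have -> : r ^+ 2 = r ^+ 2 * (cos t ^+ 2 + sin t ^+ 2).
    by rewrite cos2Dsin2 mulr1.
  rewrite sub0r; ring.
have -> : 1 = 1%:C :> R[i] by [].
rewrite -rmorphM -!rmorphB -rmorphXn -fmorphV -rmorphM.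
rewrite [X in X <= _]normc_def/= expr0n/= addr0 sqrtr_sqr.
by rewrite lecR.
Qed.

Local Close Scope complex_scope.

Lemma sqr_dist_ge r t : (1 - `|r|) ^+ 2 <= 1 - 2 * r * cos t + r ^+ 2.
Proof.
have : r * cos t <= `|r|.
  by rewrite (le_trans (ler_norm _))// normrM ler_piMr// cos_max.
rewrite sqrrB expr1n mul1r real_normK ?num_real//; lra.
Qed.

Lemma isqrt_fourier_dist r N t : `|r| < 1 ->
  `|isqrt_fourier r N t - (Num.sqrt (1 - 2 * r * cos t + r ^+ 2))^-1|
    <= `|r| ^+ N / (1 - `|r|) ^+ 2.
Proof.
move=> r1; have h := @isqrt_fourier_bound r N t r1.
have r1' : 0 < 1 - `|r| by rewrite subr_gt0.
have := sqr_dist_ge r t; set D := 1 - _ + _ in h * => Dge.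
have sD : 1 - `|r| <= Num.sqrt D.
  by rewrite -[leLHS]ger0_norm ?(ltW r1')// -sqrtr_sqr ler_wsqrtr.
have sD0 : 0 < Num.sqrt D by exact: lt_le_trans sD.
have -> : isqrt_fourier r N t - (Num.sqrt D)^-1
   = (Num.sqrt D * isqrt_fourier r N t - 1) / Num.sqrt D.
  by rewrite mulrBl mul1r mulrC mulKf// gt_eqF.
rewrite normrM normfV [`|Num.sqrt D|]gtr0_norm// expr2 invfM mulrA.
by apply: ler_pM => //; rewrite lef_pV2.
Qed.

Lemma sin_natmul_pi n : sin (n%:R * pi) = 0 :> R.
Proof.
elim: n => [|n IH]; first by rewrite mul0r sin0.
by rewrite -natr1 mulrDl mul1r sinD IH sinpi mul0r mulr0 addr0.
Qed.

Definition cos_mul_prim (a t : R) : R :=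
  if a == 0 then t else sin (a * (2 * t)) / (2 * a).

Lemma is_derive_cos_mul_prim (a t : R) :
  is_derive t 1 (cos_mul_prim a) (cos (a * (2 * t))).
Proof.
rewrite /cos_mul_prim; case: eqP => [->|/eqP a0].
  by rewrite mul0r cos0; exact: is_derive_id.
have -> : (fun t => sin (a * (2 * t)) / (2 * a))
    = (2 * a)^-1 *: (sin \o ((2 * a) *: id)).
  by apply/funext => x; rewrite /= !fctE /= mulrC mulrA [a * 2]mulrC.
apply: is_derive_eq.
have -> : ((2 * a) *: id) t = a * (2 * t).
  by change (2 * a * t = a * (2 * t)); ring.
rewrite /GRing.scale/= mulr1.
by rewrite mulrCA mulVf ?mulr1// mulf_neq0 ?pnatr_eq0.
Qed.

Definition isqrt_fourier_prim r N t : R :=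
  \sum_(i < N) \sum_(j < N)
    c i * c j * r ^+ (i + j) * cos_mul_prim (i%:R - j%:R) t.

Lemma is_derive_isqrt_fourier_prim (r : R) N (t : R) :
  is_derive t 1 (isqrt_fourier_prim r N) (isqrt_fourier r N (2 * t)).
Proof.
have -> : isqrt_fourier_prim r N = \sum_(i < N) \sum_(j < N)
    (c i * c j * r ^+ (i + j)) *: cos_mul_prim (i%:R - j%:R).
  apply/funext => x; rewrite fct_sumE; apply: eq_bigr => i _.
  by rewrite fct_sumE.
apply: is_derive_sum => i; apply: is_derive_sum => j.
have h := is_derive_cos_mul_prim (i%:R - j%:R) t.
exact: is_deriveZ.
Qed.

Lemma continuous_isqrt_fourier (r : R) N :
  continuous (fun t : R => isqrt_fourier r N (2 * t)).
Proof.
apply: continuous_big => [|i _]; first exact: add_continuous.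
apply: continuous_big => [|j _]; first exact: add_continuous.
move=> t; apply: cvgMl_tmp; apply: continuous_comp; last exact: continuous_cos.
by do 2 apply: cvgMl_tmp; exact: cvg_id.
Qed.

Lemma pihalf_gt0 : 0 < pi / 2 :> R.
Proof. by rewrite divr_gt0 ?pi_gt0. Qed.

(** The angle [2 * t] runs over half a turn, which is enough for the cosines of
    nonzero frequency to integrate to zero; only the diagonal remains. *)
Lemma integral_isqrt_fourier (r : R) N :
  \int[mu]_(t in `[0, pi / 2]) isqrt_fourier r N (2 * t)
  = pi / 2 * series (fun i => (c i * r ^+ i) ^+ 2) N.
Proof.
rewrite /Rintegral; have pi20 := pihalf_gt0.
have dP t : derivable (isqrt_fourier_prim r N) t 1.
  exact: (@ex_derive _ _ _ _ _ _ _ (is_derive_isqrt_fourier_prim r N t)).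
have cP t : {for t, continuous (isqrt_fourier_prim r N)}.
  exact/differentiable_continuous/derivable1_diffP.
rewrite (@continuous_FTC2 R _ (isqrt_fourier_prim r N) 0 (pi / 2))//.
- rewrite -EFinB /= /isqrt_fourier_prim /series/= big_mkord mulr_sumr -sumrB.
  apply: eq_bigr => i _; rewrite -sumrB (bigD1 i)//= big1 ?addr0.
    by rewrite /cos_mul_prim subrr eqxx mulr0 subr0 exprD; ring.
  move=> j ji; rewrite /cos_mul_prim subr_eq0 eqr_nat.
  rewrite (_ : (i == j :> nat) = false); last by rewrite eq_sym; exact/negbTE.
  rewrite !mulr0 sin0 mul0r mulr0 subr0.
  rewrite [2 * (_ / 2)]mulrC divfK// mulrBl sinB !sin_natmul_pi.
  by rewrite mul0r mulr0 subrr mul0r mulr0.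
- by apply: continuous_subspaceT; exact: continuous_isqrt_fourier.
- split => //.
  + by apply: cvg_at_right_filter; exact: cP.
  + by apply: cvg_at_left_filter; exact: cP.
- move=> t _; rewrite derive1E.
  exact: (@derive_val _ _ _ _ _ _ _ (is_derive_isqrt_fourier_prim r N t)).
Qed.

(** The inverse of the distance from [1] to [r e^(2it)]. *)
Definition inv_dist (r t : R) : R :=
  (Num.sqrt (1 - 2 * r * cos (2 * t) + r ^+ 2))^-1.

Lemma continuous_inv_sqrt (f : R -> R) (x : R) :
  0 < f x -> {for x, continuous f} ->
  {for x, continuous (fun x => (Num.sqrt (f x))^-1)}.
Proof.
move=> fx cf; apply: cvgV; first by rewrite gt_eqF// sqrtr_gt0.
by apply: continuous_comp => //; exact: sqrt_continuous.
Qed.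

Lemma continuous_inv_dist r : `|r| < 1 -> continuous (inv_dist r).
Proof.
move=> r1 t.
apply: (@continuous_inv_sqrt (fun t => 1 - 2 * r * cos (2 * t) + r ^+ 2)).
  by rewrite (lt_le_trans _ (sqr_dist_ge _ _))// exprn_gt0// subr_gt0.
apply: cvgD; last exact: cvg_cst.
apply: cvgB; first exact: cvg_cst.
apply: cvgMl_tmp; apply: continuous_comp; last exact: continuous_cos.
by apply: cvgMl_tmp; exact: cvg_id.
Qed.

Lemma continuous_integrable_pihalf (f : R -> R) : continuous f ->
  mu.-integrable `[0, pi / 2] (EFin \o f).
Proof.
move=> cf; apply: continuous_compact_integrable; first exact: segment_compact.
exact: continuous_subspaceT.
Qed.

(** Parseval's identity for [(1 - z) ^ (-1/2)] on the circle of radius [|r|],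
    obtained from the trigonometric polynomials [isqrt_fourier], which converge
    uniformly to [inv_dist]. *)
Lemma inv_dist_parseval (r : R) : `|r| < 1 ->
  series (fun i => (c i * r ^+ i) ^+ 2) @ \oo -->
    2 / pi * \int[mu]_(t in `[0, pi / 2]) inv_dist r t.
Proof.
move=> r1; set I := Rintegral _ _ _; set S := series _.
apply: (cvg_geometric_dist (C := (1 - `|r|) ^- 2) r1) => N.
pose H t := isqrt_fourier r N (2 * t).
have iH : mu.-integrable `[0, pi / 2] (EFin \o H).
  exact/continuous_integrable_pihalf/continuous_isqrt_fourier.
have ig : mu.-integrable `[0, pi / 2] (EFin \o inv_dist r).
  exact/continuous_integrable_pihalf/continuous_inv_dist.
have pi0 : 0 < pi :> R := pi_gt0 R.
have -> : 2 / pi * I - S N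
    = - (2 / pi * (\int[mu]_(t in `[0, pi / 2]) (H t - inv_dist r t))).
  rewrite RintegralB// integral_isqrt_fourier -/S -/I.
  by move: (pi) pi0 (I) (S N) => p p0 x s; field; rewrite gt_eqF.
rewrite normrN normrM gtr0_norm ?divr_gt0//.
rewrite mulrC -ler_pdivlMr ?divr_gt0// invf_div.
apply: le_trans (le_normr_Rintegral _ _) _ => //.
  by have := integrableB _ iH ig; apply.
rewrite [leRHS](_ : _ =
    \int[mu]_(t in `[0, pi / 2]) (`|r| ^+ N / (1 - `|r|) ^+ 2)); last first.
  by rewrite Rintegral_cst//= lebesgue_measure_itv/= lte_fin pihalf_gt0/= subr0.
apply: le_Rintegral => //.
- apply: continuous_integrable_pihalf => t; apply: cvg_norm; apply: cvgB.
    exact: continuous_isqrt_fourier.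
  exact: continuous_inv_dist.
- by apply: continuous_integrable_pihalf => t; exact: cvg_cst.
- by move=> t _; exact: isqrt_fourier_dist.
Qed.

End Fourier.

(** * The complete elliptic integral *)

Section EllipticIntegral.
Context {R : realType}.
Notation mu := (@lebesgue_measure R).
Local Notation c := (@isqrt_coef R).

Lemma bigcup_itv_sub_invr (a b : R) :
  \bigcup_n `[a, b - n.+1%:R^-1]%classic = `[a, b[%classic.
Proof.
apply/seteqP; split => [x [n _]|x] /=; rewrite !in_itv/= => /andP[ax xb].
  by rewrite ax (le_lt_trans xb)// gtrBl invr_gt0.
have [n nb] := ltr_add_invr xb; exists n => //=.
by rewrite in_itv/= ax lerBrDr ltW.
Qed.

(** The function [f] may blow up at [1], so the change of variables is done on
    the segments [[0, sin (a n)]] with [a n] increasing to [pi / 2], and passed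
    to the limit by monotone convergence on both sides. *)
Lemma integral_sin_substitution (f : R -> R) :
  {in `[0, 1[, forall x, 0 <= f x} -> {in `[0, 1[, continuous f} ->
  (\int[mu]_(x in `[0%R, 1%R[) (f x)%:E =
   \int[mu]_(t in `[0%R, (pi / 2)%R[) (f (sin t) * cos t)%:E)%E.
Proof.
move=> f0 cf; pose a n : R := pi / 2 - n.+1%:R^-1.
have a0 n : 0 <= a n.
  rewrite subr_ge0 (@le_trans _ _ 1)// ?invf_le1 ?ler1n//.
  by rewrite ler_pdivlMr// mul1r pi_ge2.
have api n : a n < pi / 2 by rewrite gtrBl invr_gt0.
have aS n : a n <= a n.+1 by rewrite lerD2l lerN2 lef_pV2 ?posrE// ler_nat.
have pi2N : - (pi / 2) <= 0 :> R by rewrite oppr_le0 ltW ?pihalf_gt0.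
have itvpi (x : R) : 0 <= x -> x <= pi / 2 -> x \in `[(- (pi / 2)), (pi / 2)].
  by move=> x0 xpi; rewrite in_itv/= (le_trans pi2N x0).
have sin01 (x : R) : 0 <= x -> x < pi / 2 -> 0 <= sin x < 1.
  move=> x0 xpi; rewrite sin_ge0_pi/=; last first.
    by rewrite x0 (le_trans (ltW xpi))// ler_pdivrMr// ler_peMr ?pi_ge0// ler1n.
  by rewrite -sin_pihalf ltr_sin// itvpi// ?ltW// pihalf_gt0.
have le_sin :
    {in `[(- (pi / 2)), (pi / 2)] &, forall x y : R, x <= y -> sin x <= sin y}.
  by move=> x y xI yI; rewrite !leNgt ltr_sin.
have bsin : \bigcup_n `[0, sin (a n)]%classic = `[0, 1[%classic :> set R.
  apply/seteqP; split => [x [n _]|x] /=; rewrite !in_itv/= => /andP[x0 x1].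
    by rewrite x0 (le_lt_trans x1)//; have /andP[] := sin01 _ (a0 n) (api n).
  have xI : -1 <= x < 1 by rewrite x1 (le_trans _ x0).
  have [n nb] := ltr_add_invr (asin_ltpi2 xI); exists n => //=.
  rewrite in_itv/= x0/= -[leLHS](@asinK R).
    have xn : asin x <= a n by rewrite lerBrDr ltW.
    apply: le_sin => //; last exact: itvpi (ltW (api n)).
    by rewrite in_itv/= asin_geNpi2 ?asin_lepi2//; apply/andP; split; lra.
  by rewrite in_itv/=; apply/andP; split; lra.
have cfs n : {in `[0, a n], forall t, {for t, continuous (fun t => f (sin t))}}.
  move=> t; rewrite in_itv/= => /andP[t0 ta].
  apply: continuous_comp; first exact: continuous_sin.
  by apply: cf; rewrite in_itv/= sin01// (le_lt_trans ta).
have cf_sub n : {within `[0, sin (a n)], continuous f}.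
  apply: continuous_in_subspaceT => x; rewrite inE/= in_itv/= => /andP[x0 xn].
  apply: cf; rewrite in_itv/= x0 (le_lt_trans xn)//.
  by have /andP[] := sin01 _ (a0 n) (api n).
have dsin : derive1 (@sin R) = cos.
  by apply/funext => x; rewrite derive1E derive_val.
have subst n : (\int[mu]_(x in `[0%R, sin (a n)]) (f x)%:E =
   \int[mu]_(t in `[0%R, a n]) (f (sin t) * cos t)%:E)%E.
  rewrite -{1}sin0.
  rewrite (@integration_by_substitution_increasing R sin f 0 (a n)) ?sin0//.
  - by apply: eq_integral => x _; rewrite dsin.
  - move=> x y; rewrite !in_itv/= => /andP[x0 xa] /andP[y0 ya] xy.
    by rewrite ltr_sin// itvpi// (le_trans _ (ltW (api n))).
  - by rewrite dsin => x _; exact: continuous_cos.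
  - rewrite dsin; apply: (cvgP (cos 0)); apply: cvg_at_right_filter.
    exact: continuous_cos.
  - rewrite dsin; apply: (cvgP (cos (a n))); apply: cvg_at_left_filter.
    exact: continuous_cos.
  - split => //.
    + by apply: cvg_at_right_filter; exact: continuous_sin.
    + by apply: cvg_at_left_filter; exact: continuous_sin.
rewrite -bsin -(bigcup_itv_sub_invr 0 (pi / 2)).
apply: (@cvg_unique _ (@ereal_hausdorff R)
  (\int[mu]_(x in `[0%R, sin (a n)]) (f x)%:E @[n --> \oo])%E).
  apply: ge0_nondecreasing_set_cvg_integral => //.
  - apply/nondecreasing_seqP => n; rewrite subsetEset; apply: subset_itvl.
    by rewrite bnd_simp le_sin// itvpi// ltW.
  - move=> n; apply/measurable_EFinP.
    exact: subspace_continuous_measurable_fun.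
  - move=> n x /=; rewrite in_itv/= => /andP[x0 xn].
    rewrite lee_fin f0// in_itv/= x0 (le_lt_trans xn)//.
    by have /andP[] := sin01 _ (a0 n) (api n).
rewrite /mkset (eq_cvg _ _ subst).
apply: ge0_nondecreasing_set_cvg_integral => //.
- apply/nondecreasing_seqP => n; rewrite subsetEset; apply: subset_itvl.
  by rewrite bnd_simp.
- move=> n; apply/measurable_EFinP.
  apply: subspace_continuous_measurable_fun => //.
  apply: continuous_in_subspaceT => x; rewrite inE/= => xn.
  by apply: continuousM; [exact: cfs xn|exact: continuous_cos].
- move=> n x /=; rewrite in_itv/= => /andP[x0 xn]; rewrite lee_fin mulr_ge0//.
    by rewrite f0// in_itv/= sin01// (le_lt_trans xn).
  rewrite cos_ge0_pihalf//; have := itvpi x x0; rewrite in_itv/=; apply.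
  by rewrite ltW// (le_lt_trans xn).
Qed.

(** For [x = sin t], [1 - k ^+ 2 * x ^+ 2] is the squared distance from [1] to
    [- q e^(2it)], divided by [(1 + q) ^+ 2]; this is what the relation between
    [k] and [q] is for, and the core of Landen's transformation. *)
Lemma ellipticK_inv_dist (q k : R) :
  0 <= q < 1 -> k ^+ 2 = 4 * q / (1 + q) ^+ 2 ->
  ellipticK k = (1 + q) * \int[mu]_(t in `[0, pi / 2]) inv_dist (- q) t.
Proof.
move=> /andP[q0 q1] kE.
have q10 : 0 < 1 + q by lra.
have k1 : k ^+ 2 < 1.
  rewrite kE ltr_pdivrMr ?exprn_gt0// mul1r.
  have : 0 < (1 - q) ^+ 2 by rewrite exprn_gt0// subr_gt0.
  by rewrite !expr2; lra.
have q1N : `|- q| < 1 by rewrite normrN ger0_norm.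
have ci := continuous_inv_dist q1N.
have dpos x : 0 <= x < 1 -> 0 < (1 - x ^+ 2) * (1 - k ^+ 2 * x ^+ 2).
  move=> /andP[x0 x1]; have x2 : x ^+ 2 < 1 by rewrite expr_lt1.
  rewrite mulr_gt0// subr_gt0//.
  by rewrite (le_lt_trans _ x2)// ler_piMl ?sqr_ge0// ltW.
rewrite /ellipticK /Rintegral integral_sin_substitution.
- rewrite -RintegralZl//; last exact: continuous_integrable_pihalf.
  have iqd : mu.-integrable `[0, pi / 2]
      (EFin \o (fun t => (1 + q) * inv_dist (- q) t)).
    by apply: continuous_integrable_pihalf => t; apply: cvgMl_tmp; exact: ci.
  rewrite -Rintegral_itv_bndo_bndc; last first.
    by apply: integrableS iqd => //; exact: subset_itv_co_cc.
  congr fine; apply: eq_integral => t; rewrite inE/= in_itv/= => /andP[t0 tpi].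
  congr (_%:E).
  have ct : 0 < cos t.
    by rewrite cos_gt0_pihalf// tpi andbT; have := @pihalf_gt0 R; lra.
  rewrite -cos2sin2 sqrtrM ?sqr_ge0// sqrtr_sqr gtr0_norm// invfM.
  rewrite mul1r mulrAC mulVf ?gt_eqF// mul1r /inv_dist.
  rewrite [2 * t]mulr_natl cos_mulr2n cos2sin2.
  have -> : 1 - 2 * - q * ((1 - sin t ^+ 2) *+ 2 - 1) + (- q) ^+ 2 =
    (1 + q) ^+ 2 * (1 - k ^+ 2 * sin t ^+ 2).
    by rewrite kE; field; rewrite gt_eqF.
  by rewrite sqrtrM ?sqr_ge0// sqrtr_sqr gtr0_norm// invfM mulVKf// gt_eqF.
- by move=> x _; rewrite divr_ge0.
- move=> x; rewrite in_itv/= => x01.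
  under eq_fun do rewrite mul1r.
  apply: (@continuous_inv_sqrt _
    (fun x => (1 - x ^+ 2) * (1 - k ^+ 2 * x ^+ 2))).
    exact: dpos.
  have cx : (fun x : R => x ^+ 2) @ x --> x ^+ 2 by exact: exprn_continuous.
  apply: cvgM; apply: cvgB; try exact: cvg_cst; first exact: cx.
  by apply: cvgMl_tmp.
Qed.

Lemma ellipticK_series (q k : R) :
  0 <= q < 1 -> k ^+ 2 = 4 * q / (1 + q) ^+ 2 ->
  series (fun i => (c i * q ^+ i) ^+ 2) @ \oo -->
    2 * ellipticK k / ((1 + q) * pi).
Proof.
move=> q01 kE; rewrite (ellipticK_inv_dist q01 kE); case/andP: q01 => q0 q1.
have -> : (fun i => (c i * q ^+ i) ^+ 2) = (fun i => (c i * (- q) ^+ i) ^+ 2).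
  by apply/funext => i; rewrite !exprMn -!exprM mulnC !exprM sqrrN.
set I := Rintegral _ _ _.
have -> : 2 * ((1 + q) * I) / ((1 + q) * pi) = 2 / pi * I.
  by move: (pi) (pi_gt0 R) (I) => p p0 x; field; rewrite !gt_eqF//; lra.
by apply: inv_dist_parseval; rewrite normrN ger0_norm.
Qed.

End EllipticIntegral.

(** * The formula for pi *)

Theorem corollary3p3 (R : realType) (b : R) (hb : 1 < b) :
  pi =
    (2 * b ^+ 2 * (b ^+ 2 - 1) * ellipticK (2 * b / (1 + b ^+ 2)))
    / ((1 + b ^+ 2)
       * (2 * (b ^+ 2 - 1)
            * appellF1 (1 / 2) 1 (1 / 2) 1 (1 / b ^+ 2) (1 / b ^+ 4)
          - b ^+ 2)).
Proof.
have b0 : 0 < b by lra.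
have b21 : 1 < b ^+ 2 by rewrite exprn_egt1.
have b20 : 0 < b ^+ 2 by lra.
set q := 1 / b ^+ 2; set k := 2 * b / _.
have q01 : 0 <= q < 1.
  by rewrite divr_ge0 ?(ltW b20)//= ltr_pdivrMr// mul1r.
have kE : k ^+ 2 = 4 * q / (1 + q) ^+ 2.
  by rewrite /k /q; field; rewrite !gt_eqF//; lra.
have -> : 1 / b ^+ 4 = q ^+ 2 by rewrite /q expr_div_n expr1n -exprM.
have Scvg := ellipticK_series q01 kE.
rewrite (appellF1_half q01 Scvg).
have K0 : ellipticK k != 0.
  (* The series has nonnegative terms and its first term is 1. *)
  apply/eqP => K0; move: Scvg; rewrite K0 mulr0 mul0r => Scvg.
  have nd : nondecreasing_seq (series (fun i => (isqrt_coef i * q ^+ i) ^+ 2)).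
    by apply: nondecreasing_series => i _ _; exact: sqr_ge0.
  have := nondecreasing_cvgn_le nd (cvgP _ Scvg) 1%N.
  rewrite (cvg_lim _ Scvg)// /series/= big_nat1 isqrt_coef0 mulr1 expr1n.
  by rewrite ler10.
move: (pi) (pi_gt0 R) (ellipticK k) K0 => p p0 K K0.
have -> : 2 * (b ^+ 2 - 1) * ((1 / (1 - q) + 2 * K / ((1 + q) * p)) / 2) - b ^+ 2
    = 2 * (b ^+ 2 - 1) * K * b ^+ 2 / ((1 + b ^+ 2) * p).
  rewrite /q; field.
  by rewrite !gt_eqF//; lra.
field.
by rewrite K0 !gt_eqF//; lra.
Qed.
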